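(* Let $p$ be a prime, $n\ge 1$, and let $C\subseteq \mathbf{F}_p^{2n}$ be a linear space with $C\subseteq C^\perp$. Let $I\subseteq\{1,\dots,n\}$, with complement $\overline{I}$, be such that $C\cap\mathbf{F}_p^I=C^\perp\cap\mathbf{F}_p^I$. Then the minimum number $N_C(I)$ of measurements to correct erasures at $I$ by the proposed scheme is $$N_C(I)=\min_{D\subseteq C}\{\dim D: C=D+(C\cap\mathbf{F}_p^{\overline{I}})\}=\dim C-\dim (C\cap\mathbf{F}_p^{\overline{I}}),$$ and this is at most $2|I|$. A subspace $D\subseteq C$ with $C=D+(C\cap\mathbf{F}_p^{\overline{I}})$ attains this minimum if and only if $D\cap\mathbf{F}_p^{\overline{I}}=\{\mathbf{0}\}$. Moreover, if $0\le\delta\le n$ and $C\cap\mathbf{F}_p^I=C^\perp\cap\mathbf{F}_p^I$ for every $I$ with $|I|=\delta$, then the worst-case number of measurements to correct $\delta$ erasures by the proposed scheme, i.e. $\max_{|I|=\delta}N_C(I)$, is $$\dim C-\min_{I\subseteq\{1,\dots,n\},\,|I|=\delta}\dim (C\cap\mathbf{F}_p^{\overline{I}}).$$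
   Context: $\mathbf{F}_p$ is the field with $p$ elements. Vectors of $\mathbf{F}_p^{2n}$ are written $(a_1,\dots,a_n|b_1,\dots,b_n)$. The symplectic inner product is $\langle (a|b),(a'|b')\rangle=\sum_{i=1}^n (a_ib'_i-a'_ib_i)$ and $C^\perp$ is the orthogonal space with respect to it. For $J\subseteq\{1,\dots,n\}$, $\mathbf{F}_p^J=\{(a|b)\in\mathbf{F}_p^{2n}: a_i=b_i=0 \text{ if } i\notin J\}$. A self-orthogonal $C$ defines a quantum stabilizer code $Q(C)$ of length $n$ over $p$-dimensional qudits; $Q(C)$ can correct erasures at the position set $I$ exactly when $C\cap\mathbf{F}_p^I=C^\perp\cap\mathbf{F}_p^I$. The proposed scheme for correcting erasures at such an $I$ is: choose a linear subspace $D\subseteq C$ with $C=D+(C\cap\mathbf{F}_p^{\overline{I}})$ and measure one observable for each vector of a basis of $D$. The number of measurements of the scheme for a given $D$ is $\dim D$, and $N_C(I)$ denotes the minimum of this number over all admissible choices of $D$. *)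

(* Defs.v *)
From HB Require Import structures.
From mathcomp Require Import all_boot all_order all_algebra.

Set Implicit Arguments.
Unset Strict Implicit.
Unset Printing Implicit Defensive.

Import GRing.Theory.
Local Open Scope ring_scope.

(* Over a finite field there are finitely many subspaces, so that one can
   minimize over all of them with [arg min_(_ < _ | _) _]. *)
Section FiniteVspace.
(* provides the subtype structure of {vspace vT} *)
Import VectorInternalTheory.

HB.instance Definition _ (F : finFieldType) (vT : vectType F) :=
  [Countable of {vspace vT} by <:].
HB.instance Definition _ (F : finFieldType) (vT : vectType F) :=
  [Finite of {vspace vT} by <:].

End FiniteVspace.

(* A vector of F_p^(2n) is a row (a|b) with blocks a = lsubmx v, b = rsubmx v. *)
Notation "''V_' ( n , p )" := 'rV['F_p]_(n + n)
  (at level 8, n, p at level 60, format "''V_' ( n ,  p )") : type_scope.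

Section SymplecticSpace.
Variables (p n : nat).
Implicit Types (u v w : 'V_(n, p)) (C D U : {vspace 'V_(n, p)}).
Implicit Types (I J : {set 'I_n}).

Definition symp v w : 'F_p :=
  \sum_(i < n) (lsubmx v 0 i * rsubmx w 0 i - lsubmx w 0 i * rsubmx v 0 i).

(* The two sets below are already subspaces, so taking their span adds
   nothing; see mem_symp_dual and mem_supp_space. *)
Definition symp_dual_set C : {set 'V_(n, p)} :=
  [set w : 'V_(n, p) | [forall v : 'V_(n, p),
     (v \in C) ==> (symp v w == 0)]].
Definition symp_dual C : {vspace 'V_(n, p)} := <<enum (symp_dual_set C)>>%VS.

Definition supp_set J : {set 'V_(n, p)} :=
  [set v : 'V_(n, p) | [forall i : 'I_n,
     (i \notin J) ==> (lsubmx v 0 i == 0) && (rsubmx v 0 i == 0)]].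
Definition supp_space J : {vspace 'V_(n, p)} := <<enum (supp_set J)>>%VS.

Definition self_orthogonal C := (C <= symp_dual C)%VS.

Definition correctable C I :=
  (C :&: supp_space I == symp_dual C :&: supp_space I)%VS.

(* D is a choice of the observables to measure for erasures at I. *)
Definition admissible C I D :=
  (D <= C)%VS && (C == D + (C :&: supp_space (~: I)))%VS.

(* N_C(I); D = C is always admissible, so the minimum is attained, see
   min_measurementsP. *)
Definition min_measurements C I : nat :=
  \dim [arg min_(D < C | admissible C I D) \dim D].

Definition worst_measurements C (delta : nat) : nat :=
  \max_(I : {set 'I_n} | #|I| == delta) min_measurements C I.

(* The unit \dim C bounds every term from above, so it does not affect the
   minimum over the (nonempty, when delta <= n) range. *)
Definition min_shortened_dim C (delta : nat) : nat :=
  \big[minn / \dim C]_(I : {set 'I_n} | #|I| == delta)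
     \dim (C :&: supp_space (~: I)).

Lemma mem_span_closed (S : {set 'V_(n, p)}) v :
  submod_closed S -> (v \in <<enum S>>%VS) = (v \in S).
Proof.
move=> [S0 SD]; apply/idP/idP => [|vS]; last first.
  by apply: memv_span; rewrite mem_enum.
move=> /(@coord_span _ _ _ (in_tuple (enum S))) ->.
apply: (big_ind (fun x => x \in S)) => // [x y xS yS | i _].
  by rewrite -[x]scale1r SD.
rewrite -[_ *: _]addr0 SD //.
have: (enum S)`_i \in enum S by rewrite mem_nth.
by rewrite mem_enum.
Qed.

Lemma mem_symp_dual C w :
  reflect (forall v, v \in C -> symp v w = 0) (w \in symp_dual C).
Proof.
rewrite mem_span_closed.
  rewrite inE; apply: (iffP forallP) => H v.
    by move=> vC; apply/eqP; move: (H v); rewrite vC.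
  by apply/implyP => vC; rewrite H.
split=> [|a x y]; rewrite !inE.
  apply/forallP => v; apply/implyP => _; rewrite /symp big1 // => i _.
  by rewrite !mxE mulr0 mul0r subr0.
move=> /forallP Hx /forallP Hy; apply/forallP => v; apply/implyP => vC.
move: (Hx v) (Hy v); rewrite vC /= => /eqP Ex /eqP Ey.
have -> : symp v (a *: x + y) = a * symp v x + symp v y.
  rewrite /symp mulr_sumr -big_split /=; apply: eq_bigr => i _.
  rewrite !mxE mulrDr mulrDl opprD addrACA mulrBr; congr (_ - _ + _).
    by rewrite mulrCA.
  by rewrite mulrA.
by rewrite Ex Ey mulr0 addr0.
Qed.

Lemma mem_supp_space J v :
  reflect (forall i, i \notin J -> lsubmx v 0 i = 0 /\ rsubmx v 0 i = 0)
          (v \in supp_space J).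
Proof.
rewrite mem_span_closed.
  rewrite inE; apply: (iffP forallP) => H i.
    by move=> iJ; move: (H i); rewrite iJ => /andP[/eqP-> /eqP->].
  by apply/implyP => iJ; have [-> ->] := H i iJ; rewrite eqxx.
split=> [|a x y]; rewrite !inE.
  by apply/forallP => i; apply/implyP => _; rewrite !mxE eqxx.
move=> /forallP Hx /forallP Hy; apply/forallP => i; apply/implyP => iJ.
move: (Hx i) (Hy i); rewrite iJ /= !mxE.
by move=> /andP[/eqP-> /eqP->] /andP[/eqP-> /eqP->]; rewrite mulr0 addr0 eqxx.
Qed.

Lemma min_measurementsP C I :
  (exists2 D, admissible C I D & \dim D = min_measurements C I) /\
  (forall D, admissible C I D -> (min_measurements C I <= \dim D)%N).
Proof.
have CC : admissible C I C.
  rewrite /admissible subvv /=; apply/eqP/esym/addv_idPl; exact: capvSl.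
rewrite /min_measurements; case: arg_minnP => // D aD minD.
by split; [exists D | move=> E /minD].
Qed.

End SymplecticSpace.

(* Main.v *)
(* Write S = C :&: F_p^(~: I).  If D is admissible then C = D + S, while
   D :&: S = D :&: F_p^(~: I) because D is contained in C, so Grassmann's formula
   gives dim D = dim C - dim S + dim (D :&: F_p^(~: I)).  The minimum is reached
   exactly when the last term vanishes, and a complement of S in C achieves it.
   Moreover S is the kernel of the restriction of C to the coordinates in I,
   whose image lies in a space of dimension 2 * #|I|. *)

From HB Require Import structures.
Require Import Defs.
From mathcomp Require Import all_boot all_order all_algebra.

Set Implicit Arguments.
Unset Strict Implicit.
Unset Printing Implicit Defensive.

Import GRing.Theory.
Local Open Scope ring_scope.

Section AdmissibleSubspaces.
Variables (p n : nat).
Implicit Types (C D : {vspace 'V_(n, p)}) (I J : {set 'I_n}).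

Lemma dim_admissible C I D : admissible C I D ->
  (\dim D + \dim (C :&: supp_space p (~: I)) =
     \dim C + \dim (D :&: supp_space p (~: I)))%N.
Proof.
case/andP=> sDC /eqP defC.
by rewrite -dimv_sum_cap -defC capvA (capv_idPl sDC).
Qed.

(** The difference [C :\: U] is a complement of [C :&: U] in [C]; it is the witness that attains the
    minimum. *)
Lemma admissible_diffv C I : admissible C I (C :\: supp_space p (~: I)).
Proof. by rewrite /admissible diffvSl addv_diff_cap eqxx. Qed.

Lemma min_measurementsE C I :
  min_measurements C I = (\dim C - \dim (C :&: supp_space p (~: I)))%N.
Proof.
have [[D aD <-] minD] := min_measurementsP C I.
apply/eqP; rewrite eqn_leq; apply/andP; split; last first.
  by rewrite leq_subLR addnC (dim_admissible aD) leq_addr.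
apply: leq_trans (minD _ (admissible_diffv C I)) _.
by rewrite -(dimv_cap_compl C (supp_space p (~: I))) addKn.
Qed.

(** Columns outside [I] are dropped rather than zeroed, so the dimension of the codomain itself
    gives the bound [2 * #|I|]. *)
Definition restrict I (v : 'V_(n, p)) : 'rV['F_p]_(#|I| + #|I|) :=
  row_mx (colsub enum_val (lsubmx v)) (colsub enum_val (rsubmx v)).

Fact restrict_is_linear I : linear (restrict I).
Proof. by move=> a u v; rewrite /restrict !linearP /= -add_row_mx -scale_row_mx. Qed.

HB.instance Definition _ I :=
  GRing.isLinear.Build _ _ _ _ (restrict I) (restrict_is_linear I).

Lemma lker_restrict I : lker (linfun (restrict I)) = supp_space p (~: I).
Proof.
apply/vspaceP => v; rewrite memv_ker lfunE /=.
apply/eqP/mem_supp_space => [v0 i | v0].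
  (* Here [i] lies in [I], so coordinate [i] of [v] is the column of the restriction at the rank of
     [i] in [I]. *)
  rewrite inE negbK => iI; rewrite -(enum_rankK_in iI iI).
  move: v0; rewrite -[0]row_mx0 => /eq_row_mx[/rowP l0 /rowP r0].
  by have:= (l0 (enum_rank_in iI i), r0 (enum_rank_in iI i)); rewrite !mxE => -[].
rewrite -[0]row_mx0; congr row_mx; apply/rowP => j;
  by have [] := v0 (enum_val j); rewrite ?inE ?negbK ?enum_valP // !mxE.
Qed.

(** Rank-nullity for [restrict I] on [C]. *)
Lemma dim_shortened_ge C I :
  (\dim C <= \dim (C :&: supp_space p (~: I)) + 2 * #|I|)%N.
Proof.
rewrite -(limg_ker_dim (linfun (restrict I)) C) lker_restrict leq_add2l.
by rewrite (leq_trans (dimvS (subvf _))) // dimvf /dim /= mul1n addnn mul2n.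
Qed.

End AdmissibleSubspaces.

(** Truncated subtraction is antitone in its second argument, so neither [a] nor [b] need be bounded
    by [m]. *)
Lemma subn_minr m : {morph subn m : a b / minn a b >-> maxn a b}.
Proof.
move=> a b; have [le_ab|/ltnW le_ba] := leqP a b.
  by rewrite (maxn_idPl (leq_sub2l m le_ab)).
by rewrite (maxn_idPr (leq_sub2l m le_ba)).
Qed.

(** The unit [m] of the minimum is sent to [m - m = 0], the unit of the maximum, so an empty range
    is covered too. *)
Lemma bigmax_subn (T : finType) (P : pred T) (m : nat) (F : T -> nat) :
  \max_(i | P i) (m - F i) = (m - \big[minn/m]_(i | P i) F i)%N.
Proof. by rewrite (big_morph (subn m) (subn_minr m) (subnn m)). Qed.

Theorem theorem5 (p n : nat) (p_prime : prime p) (n_gt0 : (0 < n)%N)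
    (C : {vspace 'V_(n, p)}) (C_so : self_orthogonal C) :
  (forall I : {set 'I_n}, correctable C I ->
     [/\ min_measurements C I
           = (\dim C - \dim (C :&: supp_space p (~: I)))%N,
         (min_measurements C I <= 2 * #|I|)%N
       & forall D : {vspace 'V_(n, p)}, admissible C I D ->
           (\dim D = min_measurements C I
            <-> (D :&: supp_space p (~: I))%VS = 0%VS)])
  /\
  (forall delta : nat, (delta <= n)%N ->
     (forall I : {set 'I_n}, #|I| = delta -> correctable C I) ->
     worst_measurements C delta = (\dim C - min_shortened_dim C delta)%N).
Proof.
split=> [I _ | delta _ _].
  split=> [||D aD].
  - exact: min_measurementsE.
  - by rewrite min_measurementsE leq_subLR dim_shortened_ge.
  - have dimD := dim_admissible aD.
    have leSC : (\dim (C :&: supp_space p (~: I)) <= \dim C)%N.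
      by rewrite dimvS ?capvSl.
    rewrite min_measurementsE; split=> [eqD | D0].
      (* Substituting [eqD] turns the left side of [dimD] into [\dim C]; cancelling it leaves an
         intersection of dimension 0. *)
      move: dimD; rewrite eqD subnK // -[LHS]addn0 => /addnI/esym/eqP.
      by rewrite dimv_eq0 => /eqP.
    by rewrite -[LHS](addnK (\dim (C :&: supp_space p (~: I)))) dimD D0 dimv0 addn0.
rewrite /worst_measurements /min_shortened_dim -bigmax_subn.
by apply: eq_bigr => I _; rewrite min_measurementsE.
Qed.
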